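(* Let $\Gamma$ be a bipartite graph of size $e$ and let $d$ be a positive divisor of $e$. If $\Gamma$ admits a $d$-graceful $\alpha$-labeling, then for every integer $n\ge 1$ there exists a cyclic $\Gamma$-decomposition of the complete multipartite graph $K_{(\frac{e}{d}+1)\times 2dn}$.
   Context: For a graph $\Gamma$ of size $e$ and a divisor $d$ of $e$ with $e=d\cdot m$, a $d$-graceful labeling of $\Gamma$ is an injective function $f:V(\Gamma)\to\{0,1,\ldots,d(m+1)-1\}$ such that $\{|f(x)-f(y)| : [x,y]\in E(\Gamma)\}=\{1,2,\ldots,d(m+1)-1\}\setminus\{m+1,2(m+1),\ldots,(d-1)(m+1)\}$. If $\Gamma$ is bipartite with parts $X,Y$, a $d$-graceful $\alpha$-labeling is a $d$-graceful labeling $f$ such that $\max f(X)<\min f(Y)$ for a suitable ordering of the two parts. $K_{a\times b}$ denotes the complete $a$-partite graph with $a$ parts each of size $b$. A $\Gamma$-decomposition of a graph $K$ is a set of subgraphs of $K$ each isomorphic to $\Gamma$ whose edge sets partition $E(K)$; it is cyclic if some bijection of $V(K)$ that is a single cycle of length $|V(K)|$ maps the set of blocks onto itself. *)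

(* Defs.v *)
From HB Require Import structures.
From mathcomp Require Import all_boot all_order all_fingroup all_algebra.

Set Implicit Arguments.
Unset Strict Implicit.
Unset Printing Implicit Defensive.

Record graph := Graph {
  vertex :> finType;
  adj : rel vertex;
  adj_sym : symmetric adj;
  adj_irr : irreflexive adj }.

Definition edges (G : graph) : {set {set G}} :=
  [set [set p.1; p.2] | p in [set p : G * G | adj p.1 p.2]].

Definition graph_size (G : graph) : nat := #|edges G|.

Definition bipartition (G : graph) (X Y : {set G}) : Prop :=
  [/\ X :|: Y = [set: G],
      [disjoint X & Y]
    & forall x y : G, adj x y ->
        (x \in X) && (y \in Y) || (x \in Y) && (y \in X)].

(* The labels {0, ..., d(m+1)-1} are the elements of 'I_(d * m.+1); the two   *)
(* sets of integers in the definition are compared extensionally.             *)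
Definition graceful_labeling (G : graph) (d m : nat)
    (f : G -> 'I_(d * m.+1)) : Prop :=
  injective f /\
  forall k : nat,
    (exists x y : G, adj x y /\ k = `|f x - f y|%N) <->
    (1 <= k <= d * m.+1 - 1 /\
     ~ (exists j : nat, 1 <= j <= d - 1 /\ k = j * m.+1)).

(* max f(A) < min f(B), read as true when A or B is empty.                    *)
Definition label_below (G : graph) (N : nat) (f : G -> 'I_N) (A B : {set G}) :=
  forall x y : G, x \in A -> y \in B -> f x < f y.

Definition graceful_alpha_labeling (G : graph) (X Y : {set G}) (d m : nat)
    (f : G -> 'I_(d * m.+1)) : Prop :=
  graceful_labeling f /\ (label_below f X Y \/ label_below f Y X).

Section CompleteMultipartite.
Variables a b : nat.

Definition multipartite_adj : rel ('I_a * 'I_b) := fun u v => u.1 != v.1.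

Lemma multipartite_adj_sym : symmetric multipartite_adj.
Proof. by move=> u v; rewrite /multipartite_adj eq_sym. Qed.

Lemma multipartite_adj_irr : irreflexive multipartite_adj.
Proof. by move=> u; rewrite /multipartite_adj eqxx. Qed.

Definition complete_multipartite : graph :=
  Graph multipartite_adj_sym multipartite_adj_irr.
End CompleteMultipartite.

(* A vertex set together with an edge set; keeping the vertex set matters     *)
(* when the graph has isolated vertices.                                      *)
Definition subgraph_data (K : graph) : finType :=
  ({set K} * {set {set K}})%type.

Definition is_subgraph (K : graph) (B : subgraph_data K) : Prop :=
  B.2 \subset edges K /\ forall E : {set K}, E \in B.2 -> E \subset B.1.

Definition isomorphic_to (G K : graph) (B : subgraph_data K) : Prop :=
  exists phi : G -> K,
    [/\ injective phi,
        phi @: [set: G] = B.1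
      & forall x y : G, adj x y = ([set phi x; phi y] \in B.2)].

(* Injectivity of snd excludes two distinct blocks sharing one edge set,      *)
(* which the partition of edge sets alone would not detect.                   *)
Definition decomposition (G K : graph) (D : {set subgraph_data K}) : Prop :=
  [/\ forall B, B \in D -> is_subgraph B /\ isomorphic_to G B,
      {in D &, injective snd}
    & partition [set B.2 | B in D] (edges K)].

Definition map_subgraph (K : graph) (s : {perm K}) (B : subgraph_data K) :
    subgraph_data K :=
  (s @: B.1, [set s @: E | E : {set K} in B.2]).

Definition single_cycle (T : finType) (s : {perm T}) : Prop :=
  porbits s = [set [set: T]].

Definition cyclic_blocks (K : graph) (D : {set subgraph_data K}) : Prop :=
  exists s : {perm K}, single_cycle s /\ map_subgraph s @: D = D.

(* Main.v *)
(* Identify the vertices of K_{(m+1) x 2dn} with Z_N, N = 2dn(m+1), so that the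
   parts are the classes mod m+1.  For i < n and g in Z_N the map adding
   g to the labels on X, and g + i d (m+1) to the (larger) labels on Y, embeds
   the graph.  For g = 0 the differences so obtained are all the non-multiples
   of m+1 below N/2, hence every arc is covered by some copy; both sides having
   the same number of arcs, each is covered exactly once.  Adding 1 permutes the
   copies. *)
Require Import Defs.
From HB Require Import structures.
From mathcomp Require Import all_boot all_order all_fingroup all_algebra.
From mathcomp Require Import zify.

Set Implicit Arguments.
Unset Strict Implicit.
Unset Printing Implicit Defensive.

(** * Edges as unordered pairs, arcs as ordered pairs *)

Lemma set2_inj (T : finType) (x y u v : T) :
  [set x; y] = [set u; v] -> x = u /\ y = v \/ x = v /\ y = u.
Proof.
move=> E.
have: x \in [set u; v] by rewrite -E set21.
have: y \in [set u; v] by rewrite -E set22.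
have: u \in [set x; y] by rewrite E set21.
have: v \in [set x; y] by rewrite E set22.
by do 4![case/set2P => ?]; subst; auto.
Qed.

Section Edges.
Variable G : graph.

Definition arcs : {set G * G} := [set p : G * G | adj p.1 p.2].

Lemma edgesP (E : {set G}) :
  reflect (exists x y : G, adj x y /\ E = [set x; y]) (E \in edges G).
Proof.
apply: (iffP imsetP) => [[[x y]]|[x [y [xy ->]]]].
  by rewrite inE /= => xy ->; exists x, y.
by exists (x, y); rewrite ?inE.
Qed.

Lemma mem_edges (x y : G) : ([set x; y] \in edges G) = adj x y.
Proof.
apply/edgesP/idP => [[u [v [uv /set2_inj [[-> ->]|[-> ->]]]]]|xy] //.
  by rewrite adj_sym.
by exists x, y.
Qed.

(** Forgetting the order maps arcs to edges, and the fibre over [[set x; y]] contains only [(x, y)]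
    and [(y, x)]. *)
Lemma card_arcs_le : #|arcs| <= 2 * graph_size G.
Proof.
rewrite -sum1_card (partition_big_imset (fun p => [set p.1; p.2])) /=.
rewrite mulnC -sum_nat_const; apply: leq_sum => E /imsetP [[x y] _ ->] /=.
rewrite sum1_card; apply: leq_trans (_ : #|[set (x, y); (y, x)]| <= _).
  apply/subset_leq_card/subsetP => -[u v]; rewrite unfold_in /= => /andP [_].
  by move=> /eqP /set2_inj [[-> ->]|[-> ->]]; rewrite !inE eqxx ?orbT.
by rewrite cards2; case: eqP.
Qed.

End Edges.

(** * Families of embedded copies: covering and counting give a decomposition *)

Section Copies.
Variables (G K : graph) (A : finType) (phi : A -> G -> K).

Definition copy (a : A) : subgraph_data K :=
  (phi a @: [set: G], [set phi a @: (E : {set G}) | E in edges G]).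

Lemma copyP (a : A) (E : {set K}) :
  reflect (exists x y : G, adj x y /\ E = [set phi a x; phi a y])
          (E \in (copy a).2).
Proof.
apply: (iffP imsetP) => [[F /edgesP [x [y [xy ->]]] ->]|[x [y [xy ->]]]].
  by exists x, y; rewrite imsetU1 imset_set1.
by exists [set x; y]; rewrite ?mem_edges // imsetU1 imset_set1.
Qed.

Hypothesis phi_inj : forall a, injective (phi a).
Hypothesis phi_hom : forall a x y, adj x y -> adj (phi a x) (phi a y).

Lemma copy_subgraph (a : A) : is_subgraph (copy a).
Proof.
split=> [|E].
  by apply/subsetP => E /copyP [x [y [xy ->]]]; rewrite mem_edges phi_hom.
by move=> /imsetP [F _ ->]; apply: imsetS; apply: subsetT.
Qed.

Lemma copy_isomorphic (a : A) : isomorphic_to G (copy a).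
Proof.
exists (phi a); split=> // x y; apply/idP/copyP => [xy|[u [v [uv]]]].
  by exists x, y.
by case/set2_inj => -[/phi_inj -> /phi_inj ->] //; rewrite adj_sym.
Qed.

Hypothesis phi_cover : forall u v : K, adj u v ->
  exists a x y, [/\ adj x y, phi a x = u & phi a y = v].
Hypothesis card_copies : #|A| * #|arcs G| <= #|arcs K|.

(** By [phi_cover] the image of [h] contains every arc of [K], and by [card_copies] its source has
    at most that many elements; hence [h] is injective. *)
Lemma copy_arc_unique (a b : A) (x y u v : G) :
  adj x y -> adj u v -> phi a x = phi b u -> phi a y = phi b v -> a = b.
Proof.
pose h (q : A * (G * G)) := (phi q.1 q.2.1, phi q.1 q.2.2).
have h_inj : {in setX [set: A] (arcs G) &, injective h}.
  apply/imset_injP; rewrite eqn_leq leq_imset_card cardsX cardsT.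
  apply: leq_trans card_copies _; apply/subset_leq_card/subsetP => -[p q].
  rewrite inE /= => /phi_cover [c [z [t [zt <- <-]]]].
  by apply/imsetP; exists (c, (z, t)); rewrite ?inE.
move=> xy uv xu yv.
have := h_inj (a, (x, y)) (b, (u, v)); rewrite !inE /h /= xu yv => H.
by case: (H xy uv erefl).
Qed.

Lemma copy_edge_unique (a b : A) (E : {set K}) :
  E \in (copy a).2 -> E \in (copy b).2 -> a = b.
Proof.
move=> /copyP [x [y [xy ->]]] /copyP [u [v [uv]]].
case/set2_inj => -[]; first exact: copy_arc_unique.
by apply: copy_arc_unique; rewrite // adj_sym.
Qed.

Lemma copies_decomposition :
  0 < graph_size G -> decomposition G [set copy a | a in [set: A]].
Proof.
(* The images of one fixed edge of [G] serve twice: they recover the index of a copy from its edge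
   set, and they show that no class of the partition is empty. *)
case/card_gt0P => E0 /edgesP [x0 [y0 [xy0 _]]].
have edge0 a : [set phi a x0; phi a y0] \in (copy a).2.
  by apply/copyP; exists x0, y0.
split.
- by move=> _ /imsetP [a _ ->]; split; [apply: copy_subgraph|apply: copy_isomorphic].
- move=> _ _ /imsetP [a _ ->] /imsetP [b _ ->] ab.
  by congr copy; apply: (@copy_edge_unique a b _ (edge0 a)); rewrite -ab.
apply/and3P; split.
- rewrite eqEsubset; apply/andP; split; apply/subsetP => E.
    case/bigcupP => _ /imsetP [_ /imsetP [a _ ->] ->].
    exact/subsetP/(proj1 (copy_subgraph a)).
  case/edgesP => u [v [/phi_cover [a [x [y [xy <- <-]]]] ->]].
  apply/bigcupP; exists (copy a).2; last by apply/copyP; exists x, y.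
  by apply: imset_f; apply: imset_f; rewrite inE.
- apply/trivIsetP => _ _ /imsetP [_ /imsetP [a _ ->] ->]
    /imsetP [_ /imsetP [b _ ->] ->] ab; rewrite -setI_eq0.
  apply: contraNT ab => /set0Pn [E /setIP [Ea Eb]].
  by rewrite (copy_edge_unique Ea Eb).
- apply/negP => /imsetP [_ /imsetP [a _ ->]] E0a.
  by have := edge0 a; rewrite -E0a inE.
Qed.

(** By equivariance [s] sends the copy of index [a] to that of index [t a], and [t] is onto. *)
Lemma map_copies (s : {perm K}) (t : {perm A}) :
  (forall a x, s (phi a x) = phi (t a) x) ->
  map_subgraph s @: [set copy a | a in [set: A]] = [set copy a | a in [set: A]].
Proof.
move=> st.
have sc a : map_subgraph s (copy a) = copy (t a).
  rewrite /map_subgraph /copy /= -imset_comp -[X in (_, X)]imset_comp.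
  congr pair; first by apply: eq_imset => x /=.
  by apply: eq_imset => E /=; rewrite -imset_comp; apply: eq_imset => x /=.
apply/setP => B; apply/imsetP/imsetP => [[_ /imsetP [a _ ->] ->]|[a _ ->]].
  by exists (t a).
exists (copy ((t^-1)%g a)); first by apply: imset_f; rewrite inE.
by rewrite sc permKV.
Qed.

End Copies.

Lemma card_arcs_multipartite (a b : nat) :
  #|arcs (complete_multipartite a b)| = a * b * (a.-1 * b).
Proof.
rewrite -sum1_card.
under eq_bigl => p do rewrite inE.
rewrite -(pair_big_dep xpredT (fun u v => adj u v) (fun _ _ => 1)) /=.
rewrite (eq_bigr (fun=> a.-1 * b)) => [|u _].
  by rewrite sum_nat_const card_prod !card_ord.
(* The neighbours of [u] form the product of the parts other than [u.1] with all of ['I_b]. *)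
rewrite sum1_card -[in a.-1](card_ord a) -(cardsC1 u.1) -[X in _ * X]card_ord.
rewrite -cardsT -cardsX; apply: eq_card => v.
by rewrite !inE andbT eq_sym.
Qed.

(** * The vertices as residues mod N, and the shift by 1 *)

Section CyclicVertices.
Variables (m b : nat) (b_gt0 : 0 < b).
Let N := m.+1 * b.
Hypothesis N_gt1 : 1 < N.

Lemma val_ZpD (z w : 'Z_N) : val (z + w)%R = (z + w) %% N.
Proof. by congr (_ %% _); apply: Zp_cast. Qed.

Lemma ltn_Zp (z : 'Z_N) : z < N.
Proof. by rewrite -[X in _ < X](Zp_cast N_gt1) ltn_ord. Qed.

(** Euclidean division by [m.+1]: the remainder names the part, the quotient the place within it.
    Reduction mod [b] supplies the ordinal's bound and leaves the quotient unchanged when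
    [1 < N]. *)
Definition vertex_of (z : 'Z_N) : complete_multipartite m.+1 b :=
  (Ordinal (ltn_pmod z (ltn0Sn m)), Ordinal (ltn_pmod (z %/ m.+1) b_gt0)).

Lemma vertex_of_bij : bijective vertex_of.
Proof.
apply: inj_card_bij => [z w [zw1 zw2]|]; last first.
  by rewrite card_prod !card_ord Zp_cast.
have quo (t : 'Z_N) : t %/ m.+1 %% b = t %/ m.+1.
  by rewrite modn_small // ltn_divLR // mulnC ltn_Zp.
by apply: val_inj; rewrite /= (divn_eq z m.+1) (divn_eq w m.+1) zw1 -quo zw2 quo.
Qed.

Lemma adj_vertex_of (z w : 'Z_N) :
  adj (vertex_of z) (vertex_of w) = (z %% m.+1 != w %% m.+1).
Proof. by []. Qed.

(** Reduction mod [N] preserves classes mod [m.+1], a divisor of [N]. *)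
Lemma modn_ZpD_nat (z : 'Z_N) (k : nat) : (z + k%:R)%R %% m.+1 = (z + k) %% m.+1.
Proof.
by rewrite val_ZpD val_Zp_nat // modn_dvdm ?dvdn_mulr // -modnDmr modn_dvdm
  ?dvdn_mulr // modnDmr.
Qed.

Lemma exists_shift : exists s : {perm complete_multipartite m.+1 b},
  single_cycle s /\ forall z, s (vertex_of z) = vertex_of (z + 1)%R.
Proof.
have [g vK gK] := vertex_of_bij.
have sI : injective (fun u => vertex_of (g u + 1)%R).
  by move=> u v /(can_inj vK) /GRing.addIr /(can_inj gK).
have sE z : perm sI (vertex_of z) = vertex_of (z + 1)%R by rewrite permE vK.
exists (perm sI); split => //.
have orbT u : porbit (perm sI) u = [set: complete_multipartite m.+1 b].
  (* The number of steps from [u] to [v] is the difference of their residues, since [k] shifts add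
     [k]. *)
  apply/setP => v; rewrite inE; apply/porbitP; exists (nat_of_ord (g v - g u)%R).
  have sX k : (perm sI ^+ k)%g u = vertex_of (g u + k%:R)%R.
    elim: k => [|k IH]; first by rewrite expg0 perm1 GRing.addr0 gK.
    by rewrite expgSr permM IH sE -GRing.addrA GRing.natr1.
  by rewrite sX natr_Zp GRing.addrC GRing.subrK gK.
apply/setP => O; rewrite inE; apply/imsetP/eqP => [[u _ ->]|->] //.
by exists (vertex_of 0%R).
Qed.

End CyclicVertices.

(** * The copies obtained from the labeling *)

Section AlphaCopies.
Variables (G : graph) (X Y : {set G}) (d m n : nat).
Variable f : G -> 'I_(d * m.+1).
Hypothesis d_gt0 : 0 < d.
Hypothesis n_gt0 : 0 < n.
Hypothesis XY : bipartition X Y.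
Hypothesis f_graceful : graceful_labeling f.
Hypothesis f_alpha : label_below f X Y.

Let b := 2 * d * n.
Let N := m.+1 * b.

Lemma part_size_gt0 : 0 < b.
Proof. by rewrite /b; lia. Qed.

Lemma order_gt1 : 1 < N.
Proof. by rewrite /N /b; nia. Qed.

Definition stretch (i : 'I_n) (x : G) : nat :=
  f x + (x \in Y) * (i * (d * m.+1)).

Lemma in_XY (x : G) : (x \in X) = (x \notin Y).
Proof.
case: XY => cov /setDidPl dis _; apply/idP/idP => [|xY].
  by rewrite -dis inE => /andP [].
by have := in_setT x; rewrite -cov inE (negPf xY) orbF.
Qed.

Lemma stretch_lt (i : 'I_n) (x : G) : stretch i x < n * (d * m.+1).
Proof.
have := ltn_ord i; have := ltn_ord (f x); rewrite /stretch.
by case: (x \in Y); nia.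
Qed.

(** The added amount is constant on each part, and raising [Y], which already lies above [X], keeps
    the parts apart. *)
Lemma stretch_inj (i : 'I_n) : injective (stretch i).
Proof.
have [f_inj _] := f_graceful.
move=> x y; rewrite /stretch; case xY: (x \in Y); case yY: (y \in Y) => E.
- by apply/f_inj/val_inj => /=; lia.
- by have := f_alpha (x := y) (y := x); rewrite in_XY yY xY => /(_ isT isT); lia.
- by have := f_alpha (x := x) (y := y); rewrite in_XY yY xY => /(_ isT isT); lia.
- by apply/f_inj/val_inj => /=; lia.
Qed.

(** Stretching adds multiples of [m.+1], so a congruence would make [|f x - f y|] equal to
    [j * m.+1]; its bounds force [1 <= j <= d - 1], a value that gracefulness excludes. *)
Lemma stretch_modn (i : 'I_n) (x y : G) :
  adj x y -> stretch i x %% m.+1 != stretch i y %% m.+1.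
Proof.
have [_ fP] := f_graceful => xy; rewrite /stretch !mulnA.
rewrite ![f _ + _]addnC !modnMDl.
have [kb kM] := (fP _).1 (ex_intro _ x (ex_intro _ y (conj xy erefl))).
apply/negP => /eqP E; apply: kM.
have /dvdnP [j jE] : m.+1 %| `|f x - f y|%N.
  case: (leqP (f x) (f y)) => h.
    by rewrite distnEr // -eqn_mod_dvd //; apply/eqP.
  by rewrite distnEl ?(ltnW h) // -eqn_mod_dvd ?(ltnW h) //; apply/eqP.
exists j; split=> //; nia.
Qed.

Definition alpha_copy (a : 'I_n * 'Z_N) (x : G) : complete_multipartite m.+1 b :=
  vertex_of part_size_gt0 (a.2 + (stretch a.1 x)%:R)%R.

Lemma alpha_copy_inj a : injective (alpha_copy a).
Proof.
move=> x y /(bij_inj (vertex_of_bij part_size_gt0 order_gt1)) /GRing.addrI E.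
apply: (@stretch_inj a.1); move/(congr1 val): E => /=.
(* Stretched labels stay below N / 2, so reduction mod [N] does not alter them. *)
have bd z : stretch a.1 z < N.
  by have := stretch_lt a.1 z; rewrite /N /b; nia.
by rewrite !(val_Zp_nat order_gt1) !modn_small.
Qed.

Lemma alpha_copy_hom a x y : adj x y -> adj (alpha_copy a x) (alpha_copy a y).
Proof.
move=> xy; rewrite adj_vertex_of !(modn_ZpD_nat order_gt1) eqn_modDl.
exact: stretch_modn.
Qed.

(** Divide [k] by [L = d * m.+1]. The quotient selects [i]; the remainder, like [k], is no multiple
    of [m.+1], hence is a difference [f y - f x] with [x] in [X]. Translating by [z - f x] brings
    [x] to [z] and [y] to [z + k]. *)
Lemma alpha_copy_half (z : 'Z_N) (k : nat) :
  k < n * (d * m.+1) -> ~~ (m.+1 %| k) ->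
  exists a x y, [/\ adj x y, alpha_copy a x = vertex_of part_size_gt0 z
                  & alpha_copy a y = vertex_of part_size_gt0 (z + k%:R)%R].
Proof.
move=> k_lt k_M; have [_ fP] := f_graceful; have [_ _ adjXY] := XY.
have L_gt0 : 0 < d * m.+1 by rewrite muln_gt0 d_gt0.
set L := d * m.+1 in k_lt L_gt0 fP *.
have i_lt : k %/ L < n by rewrite ltn_divLR.
have kL : ~~ (m.+1 %| k %% L).
  by rewrite /dvdn modn_dvdm ?dvdn_mull.
have k0 : 0 < k %% L by rewrite lt0n; apply: contraNneq kL => ->; rewrite dvdn0.
have /fP [x [y [xy kE]]] : 0 < k %% L <= L - 1 /\
    ~ (exists j : nat, 0 < j <= d - 1 /\ k %% L = j * m.+1).
  split; first by have := ltn_pmod k L_gt0; lia.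
  by case=> j [_ E]; rewrite E dvdn_mull in kL.
wlog [xX yY] : x y xy kE / x \in X /\ y \in Y.
  move=> H; case/orP: (adjXY _ _ xy) => /andP [hx hy]; first exact: (H x y).
  apply: (H y x); [by rewrite adj_sym| |by split].
  by rewrite kE distnC.
have fxy := f_alpha xX yY; rewrite in_XY in xX.
pose i := Ordinal i_lt.
have sx : stretch i x = f x by rewrite /stretch (negPf xX) mul0n addn0.
have sy : stretch i y = f x + k.
  rewrite /stretch yY mul1n /= [in RHS](divn_eq k L) kE -/L.
  by rewrite distnEr ?(ltnW fxy) // addnCA addnC subnKC // ltnW.
exists (i, (z - (f x)%:R)%R), x, y; split=> //; rewrite /alpha_copy /= ?sx ?sy.
  by rewrite GRing.subrK.
by rewrite GRing.natrD GRing.addrA GRing.subrK.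
Qed.

(* A difference and its opposite cannot both be at least N / 2: otherwise both
   equal N / 2, a multiple of m + 1. *)
Lemma alpha_copy_cover u v : adj u v ->
  exists a x y, [/\ adj x y, alpha_copy a x = u & alpha_copy a y = v].
Proof.
have [g vK gK] := vertex_of_bij part_size_gt0 order_gt1.
rewrite -(gK u) -(gK v); move: (g u) (g v) => z w.
have nM (p q : 'Z_N) : p %% m.+1 != q %% m.+1 -> ~~ (m.+1 %| (q - p)%R).
  apply: contra => /dvdnP [j jE].
  rewrite -[q](GRing.subrK p) GRing.addrC -[(q - p)%R]natr_Zp.
  by rewrite (modn_ZpD_nat order_gt1) jE addnC modnMDl.
rewrite adj_vertex_of => zw.
case: (ltnP (w - z)%R (n * (d * m.+1))) => [lt|ge].
  have [a [x [y [xy xE yE]]]] := alpha_copy_half z lt (nM _ _ zw).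
  exists a, x, y; split=> //.
  by rewrite yE natr_Zp GRing.addrC GRing.subrK.
have lt : (z - w)%R < n * (d * m.+1).
  rewrite ltnNge; apply/negP => ge'.
  have /(congr1 val) : ((w - z) + (z - w) = 0 :> 'Z_N)%R.
    by rewrite -[(z - w)%R]GRing.opprB GRing.subrr.
  rewrite (val_ZpD order_gt1) => /eqP /dvdnP [j jE].
  have := nM _ _ zw; have := ltn_Zp order_gt1 (w - z)%R; have := ltn_Zp order_gt1 (z - w)%R.
  move: (nat_of_ord (w - z)%R) (nat_of_ord (z - w)%R) ge ge' jE => p q.
  move=> ge ge' jE q_lt p_lt.
  have NE : N = 2 * (n * (d * m.+1)) by rewrite /N /b; lia.
  have j_lt2 : j < 2 by rewrite -(ltn_pmul2r (ltnW order_gt1)) -jE; lia.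
  have -> : p = n * (d * m.+1) by case: j j_lt2 jE => [|[]] //; lia.
  by rewrite mulnA dvdn_mull.
rewrite eq_sym in zw.
have [a [x [y [xy xE yE]]]] := alpha_copy_half w lt (nM _ _ zw).
exists a, y, x; split=> //; first by rewrite adj_sym.
by rewrite yE natr_Zp GRing.addrC GRing.subrK.
Qed.

Lemma alpha_copies_cyclic : graph_size G = d * m ->
  exists D : {set subgraph_data (complete_multipartite m.+1 (2 * d * n))},
    decomposition G D /\ cyclic_blocks D.
Proof.
move=> size_G; have [s [s_cycle sE]] := exists_shift part_size_gt0 order_gt1.
(* For [m = 0] the host has a single part and no edges, so the empty set of blocks works. For
   [m > 0] the graph [G] has an edge, as [copies_decomposition] requires. *)
case: (posnP m) => [m0|m_gt0].
  have val0 (i : 'I_m.+1) : i = 0 :> nat by case: i => i /=; lia.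
  have K0 : edges (complete_multipartite m.+1 b) = set0.
    apply/setP => E; rewrite inE; apply/negP => /edgesP [u [v [uv _]]].
    move: uv; rewrite /= /multipartite_adj; case/eqP; apply: val_inj => /=.
    by rewrite !val0.
  exists set0; split; last by exists s; rewrite imset0.
  split=> [B|B C|]; rewrite ?inE // imset0 K0.
  by rewrite /partition /trivIset /cover !big_set0 cards0 inE !eqxx.
exists [set copy alpha_copy a | a in [set: 'I_n * 'Z_N]].
split.
  apply: copies_decomposition.
  - exact: alpha_copy_inj.
  - exact: alpha_copy_hom.
  - exact: alpha_copy_cover.
  (* Since [b = 2 * d * n], the bound is exact: [n * N * (2 * (d * m)) = N * (m * b)]. *)
  - rewrite card_arcs_multipartite card_prod !card_ord (Zp_cast order_gt1).
    have := card_arcs_le G; rewrite size_G => le.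
    apply: leq_trans (leq_mul (leqnn (n * N)) le) _.
    by rewrite /= /N /b; lia.
  - by rewrite size_G muln_gt0 d_gt0.
exists s; split=> //.
(* On indices the shift fixes [i] and adds 1 to the translation. *)
have tI : injective (fun a : 'I_n * 'Z_N => (a.1, a.2 + 1)%R).
  move=> [i z] [j w] E; congr pair; first exact: (congr1 fst E).
  by apply: (@GRing.addIr _ 1%R); exact: (congr1 snd E).
apply: (map_copies (t := perm tI)) => a x.
by rewrite permE /alpha_copy sE /= -!GRing.addrA (GRing.addrC _ 1%R).
Qed.

End AlphaCopies.

Theorem theorem2p6 (G : graph) (X Y : {set G}) (e d : nat)
    (hXY : bipartition X Y)
    (he : graph_size G = e)
    (hd : 0 < d) (hde : d %| e)
    (hf : exists f : G -> 'I_(d * (e %/ d).+1),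
            graceful_alpha_labeling X Y f) :
  forall n : nat, 1 <= n ->
    exists D : {set subgraph_data (complete_multipartite (e %/ d + 1) (2 * d * n))},
      decomposition G D /\ cyclic_blocks D.
Proof.
move=> n n_gt0; rewrite addn1; case: hf => f [fG fA].
have size_G : graph_size G = d * (e %/ d) by rewrite mulnC divnK.
(* Either part may carry the smaller labels; [alpha_copies_cyclic] takes that part first, so the
   second case exchanges [X] and [Y]. *)
have hYX : bipartition Y X.
  case: hXY => cov dis aXY; split; first by rewrite setUC.
    by rewrite disjoint_sym.
  by move=> x y /aXY; rewrite orbC.
case: fA => fA.
  exact: (alpha_copies_cyclic hd n_gt0 hXY fG fA).
exact: (alpha_copies_cyclic hd n_gt0 hYX fG fA).
Qed.
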